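(* Let $\mathcal{H}$ be a complex Hilbert space, let $T\in\mathcal{B}(\mathcal{H})$ be generalized Drazin invertible with closed range, and let $T^{-}$ be a fixed inner inverse of $T$. Then $X=T^dTT^{-}$ is the unique operator $X\in\mathcal{B}(\mathcal{H})$ satisfying $$TX=P_{\mathcal{R}(TT^dT),\,\mathcal{N}(T^dT^{-})}\quad\text{and}\quad \mathcal{R}(X)\subset\mathcal{R}(TT^d).$$
   Context: $\mathcal{B}(\mathcal{H})$ is the space of bounded linear operators on $\mathcal{H}$; $\mathcal{R}(\cdot)$ and $\mathcal{N}(\cdot)$ denote range and null space. An operator $Q\in\mathcal{B}(\mathcal{H})$ is quasinilpotent if $\|Q^n\|^{1/n}\to0$ (equivalently, $\lambda I-Q$ is invertible for all $\lambda\neq0$). $T\in\mathcal{B}(\mathcal{H})$ is generalized Drazin invertible if there is $X\in\mathcal{B}(\mathcal{H})$ with $XTX=X$, $TX=XT$ and $T-T^2X$ quasinilpotent; such an $X$ is unique and is denoted $T^d$. An inner inverse of $T$ is an operator $T^{-}\in\mathcal{B}(\mathcal{H})$ with $TT^{-}T=T$ (one exists iff $\mathcal{R}(T)$ is closed). $P_{M,N}$ denotes the (not necessarily orthogonal) projector, i.e. bounded idempotent, with range $M$ and null space $N$; the equation $TX=P_{M,N}$ means that $TX$ is idempotent with range $M$ and null space $N$. *)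

(* Defs.v *)
From HB Require Import structures.
From mathcomp Require Import all_boot all_order all_algebra.
From mathcomp Require Import complex.
From mathcomp Require Import mathcomp_extra boolp classical_sets functions reals.
From mathcomp Require Import topology normedtype sequences exp.

Set Implicit Arguments.
Unset Strict Implicit.
Unset Printing Implicit Defensive.

Import Order.TTheory GRing.Theory Num.Theory.
Import numFieldNormedType.Exports.

Local Open Scope classical_set_scope.
Local Open Scope ring_scope.
Local Open Scope complex_scope.

(* The inner product is linear in its first argument and conjugate-linear in
   the second, as fixed by [{dot _ for _}]. *)
HB.mixin Record CompleteNormedModule_isHilbert (R : realType) H
    of CompleteNormedModule R[i] H := {
  hdot : {dot H for (Num.conj : R[i] -> R[i])} ;
  hdot_norm : forall x : H, hdot x x = `|x| ^+ 2 }.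

#[short(type="hilbertType")]
HB.structure Definition Hilbert (R : realType) :=
  { H of CompleteNormedModule_isHilbert R H & CompleteNormedModule R[i] H }.

Record bop (R : realType) (H : hilbertType R) := Bop {
  bop_fun :> H -> H ;
  bop_linear : linear bop_fun ;
  bop_bounded : bounded_near bop_fun (nbhs (0 : H)) }.

HB.instance Definition _ (R : realType) (H : hilbertType R) (f : bop H) :=
  GRing.isLinear.Build R[i] H H *:%R f (@bop_linear R H f).
HB.instance Definition _ (R : realType) (H : hilbertType R) :=
  gen_eqMixin (bop H).
HB.instance Definition _ (R : realType) (H : hilbertType R) :=
  gen_choiceMixin (bop H).

Section bop_ring.
Context {R : realType} {H : hilbertType R}.
Implicit Types f g h : bop H.

Lemma bopP f g : f =1 g -> f = g.
Proof.
case: f => f lf bf; case: g => g lg bg /= /funext fg.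
by subst g; congr Bop; exact: Prop_irrelevance.
Qed.

Lemma bop_continuous f : continuous f.
Proof. exact/linear_bounded_continuous/bop_bounded. Qed.

Lemma bounded_of_continuous (f : {linear H -> H}) :
  continuous f -> bounded_near f (nbhs (0 : H)).
Proof. by move=> /linear_bounded_continuous. Qed.

Let bop_of (f : {linear H -> H}) (cf : continuous f) : bop H :=
  Bop (@linearP _ _ _ _ f) (bounded_of_continuous cf).

Lemma bop0_continuous : continuous (\0 : {linear H -> H}).
Proof. by move=> x; exact: cvg_cst. Qed.

Lemma bop1_continuous : continuous (idfun : {linear H -> H}).
Proof. by move=> x; exact: cvg_id. Qed.

Lemma bopN_continuous f : continuous (\- f : {linear H -> H}).
Proof. by move=> x; apply: cvgN; exact: bop_continuous. Qed.

Lemma bopD_continuous f g : continuous (f \+ g : {linear H -> H}).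
Proof. by move=> x; apply: cvgD; exact: bop_continuous. Qed.

Lemma bopM_continuous f g : continuous (f \o g : {linear H -> H}).
Proof. by move=> x; apply: continuous_comp; exact: bop_continuous. Qed.

Definition bop0 : bop H := bop_of bop0_continuous.
Definition bop1 : bop H := bop_of bop1_continuous.
Definition bopN f : bop H := bop_of (@bopN_continuous f).
Definition bopD f g : bop H := bop_of (@bopD_continuous f g).
Definition bopM f g : bop H := bop_of (@bopM_continuous f g).

Fact bopDA : associative bopD.
Proof. by move=> f g h; apply: bopP => x /=; rewrite addrA. Qed.
Fact bopDC : commutative bopD.
Proof. by move=> f g; apply: bopP => x /=; rewrite addrC. Qed.
Fact bop0D : left_id bop0 bopD.
Proof. by move=> f; apply: bopP => x /=; rewrite add0r. Qed.
Fact bopND : left_inverse bop0 bopN bopD.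
Proof. by move=> f; apply: bopP => x /=; rewrite addNr. Qed.

HB.instance Definition _ :=
  GRing.isZmodule.Build (bop H) bopDA bopDC bop0D bopND.

Fact bopMA : associative bopM.
Proof. by move=> f g h; apply: bopP. Qed.
Fact bop1M : left_id bop1 bopM.
Proof. by move=> f; apply: bopP. Qed.
Fact bopM1 : right_id bop1 bopM.
Proof. by move=> f; apply: bopP. Qed.
Fact bopMDl : left_distributive bopM bopD.
Proof. by move=> f g h; apply: bopP. Qed.
Fact bopMDr : right_distributive bopM bopD.
Proof. by move=> f g h; apply: bopP => x /=; rewrite linearD. Qed.

(* Only a possibly trivial ring: H may be the zero space. *)
HB.instance Definition _ :=
  GRing.Zmodule_isPzRing.Build (bop H) bopMA bop1M bopM1 bopMDl bopMDr.

Lemma bop_mulE f g (x : H) : (f * g) x = f (g x).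
Proof. by []. Qed.

Lemma bop_addE f g (x : H) : (f + g) x = f x + g x.
Proof. by []. Qed.

Lemma bop_oppE f (x : H) : (- f) x = - f x.
Proof. by []. Qed.

Lemma bop_oneE (x : H) : (1 : bop H) x = x.
Proof. by []. Qed.

End bop_ring.

Section operators.
Context {R : realType} {H : hilbertType R}.
Implicit Types T X P Q : bop H.

Definition nullspace T : set H := [set x | T x = 0].

(* Norms on H take values in R[i]; they are real, so [complex.Re] only
   changes their type. *)
Definition opnorm T : R :=
  sup [set complex.Re `|T x| | x in [set x : H | `|x| <= 1]].

Definition quasinilpotent Q : Prop :=
  opnorm (Q ^+ n) `^ n%:R^-1 @[n --> \oo] --> (0 : R).

Definition gdrazin_inverse T X : Prop :=
  [/\ X * T * X = X, T * X = X * T & quasinilpotent (T - T ^+ 2 * X)].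

Definition inner_inverse T X : Prop := T * X * T = T.

Definition projector_on_along P (M N : set H) : Prop :=
  [/\ P * P = P, range P = M & nullspace P = N].

End operators.

(* Main.v *)
Require Import Defs.
From mathcomp Require Import all_boot all_order all_algebra.
From mathcomp Require Import complex.
From mathcomp Require Import boolp classical_sets functions reals.
From mathcomp Require Import topology normedtype.
Import GRing.Theory.
Import numFieldNormedType.Exports.

Local Open Scope classical_set_scope.
Local Open Scope ring_scope.

(** Write [p = T Td = Td T], an idempotent with [p Td = Td]. For existence,
    [T (Td T Tm) = T ^ 2 (Td Tm)] and [Td Tm = Td ^ 2 (T (Td T Tm))], so these two
    operators have the same null space. For uniqueness, a projector is determined
    by its range and null space, so [T X] is determined, and the range condition
    says [X = p X = Td (T X)]. *)

Lemma nullspace_mull (R : realType) (H : hilbertType R) (A B : bop H) :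
  nullspace B `<=` nullspace (A * B).
Proof. by move=> x Bx0; rewrite /nullspace mksetE bop_mulE Bx0 linear0. Qed.

Lemma range_mulr (R : realType) (H : hilbertType R) (A B : bop H) :
  range (A * B) `<=` range A.
Proof. by move=> _ [x _ <-]; exists (B x). Qed.

Lemma idempotent_range_id (R : realType) (H : hilbertType R) (P : bop H) (x : H) :
  P * P = P -> range P x -> P x = x.
Proof. by move=> PP [y _ <-]; rewrite -bop_mulE PP. Qed.

Lemma idempotent_mul_id (R : realType) (H : hilbertType R) (P X : bop H) :
  P * P = P -> range X `<=` range P -> P * X = X.
Proof.
move=> PP sXP; apply: bopP => x; rewrite bop_mulE.
by apply: idempotent_range_id => //; apply: sXP; exists x.
Qed.

(** [Q] fixes each [P x], which lies in the common range [M], and kills each [x - P x], which lies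
    in the common null space [N]; hence [Q x = P x]. *)
Lemma projector_on_along_inj (R : realType) (H : hilbertType R)
    (P Q : bop H) (M N : set H) :
  projector_on_along P M N -> projector_on_along Q M N -> P = Q.
Proof.
move=> [PP rP nP] [QQ rQ nQ]; apply: bopP => x.
have QP : Q (P x) = P x.
  by apply: idempotent_range_id => //; rewrite rQ -rP; exists x.
have : nullspace Q (x - P x).
  by rewrite nQ -nP /nullspace mksetE linearB /= -bop_mulE PP subrr.
by rewrite /nullspace mksetE linearB /= QP => /subr0_eq.
Qed.

Lemma gdrazin_inner_projector (R : realType) (H : hilbertType R) (T Td Tm : bop H) :
  Td * T * Td = Td -> T * Td = Td * T -> T * Tm * T = T ->
  projector_on_along (T * (Td * T * Tm)) (range (T * Td * T))
    (nullspace (Td * Tm)).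
Proof.
move=> TdTTd TTd TTmT.
(* This collapse of [T * Tm * T] shortens the square in the idempotence proof and also writes
   [T * Td * T] as a right multiple of [T * (Td * T * Tm)], which gives the harder range
   inclusion. *)
have TXT : T * (Td * T * Tm) * T = T * Td * T.
  by rewrite !mulrA -(mulrA (T * Td) T) -(mulrA (T * Td) (T * Tm)) TTmT.
split.
- by rewrite mulrA TXT !mulrA -(mulrA T Td T) -(mulrA T (Td * T)) TdTTd !mulrA.
- apply/seteqP; split; first by rewrite !mulrA; exact: range_mulr.
  by rewrite -TXT; exact: range_mulr.
- apply/seteqP; split.
    have -> : Td * Tm = Td * Td * (T * (Td * T * Tm)).
      (* [Td * T * Td = Td] is used twice, the second time after commuting [Td * T]. *)
      rewrite !mulrA -(mulrA Td Td T) -(mulrA Td (Td * T)) TdTTd.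
      by rewrite -(mulrA Td Td T) -TTd mulrA TdTTd.
    exact: nullspace_mull.
  have -> : T * (Td * T * Tm) = T * T * (Td * Tm) by rewrite -TTd !mulrA.
  exact: nullspace_mull.
Qed.

Theorem proposition1 (R : realType) (H : hilbertType R) (T Td Tm : bop H)
    (hTd : gdrazin_inverse T Td)
    (hclosed : closed (range T))
    (hTm : inner_inverse T Tm) :
  unique (fun X : bop H =>
            projector_on_along (T * X) (range (T * Td * T)) (nullspace (Td * Tm))
            /\ range X `<=` range (T * Td))
         (Td * T * Tm).
Proof.
have [TdTTd TTd _] := hTd.
have projX := gdrazin_inner_projector _ _ _ _ _ TdTTd TTd hTm.
have sX : range (Td * T * Tm) `<=` range (T * Td).
  by rewrite -TTd; exact: range_mulr.
have pp : T * Td * (T * Td) = T * Td by rewrite -mulrA (mulrA Td) TdTTd.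
split=> [//|Y [projY sY]].
have TXY := projector_on_along_inj _ _ _ _ _ _ projX projY.
(* Both sides get the prefix [T * Td]; turned into [Td * T], it exposes the products that [TXY]
   identifies. *)
rewrite -(idempotent_mul_id _ _ _ _ pp sX) -(idempotent_mul_id _ _ _ _ pp sY).
by rewrite TTd -(mulrA Td T Y) -TXY !mulrA.
Qed.
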